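(* Let $G$ be a finite simple graph, let $r\ge2$ be an integer, and let $f,g$ be two $k$-vertex-colorings of $G$. Then $f\sim_r g$ if and only if $\mathbf{x}_f-\mathbf{x}_g\in J_{G,r}$.
   Context: A $k$-vertex-coloring of a graph is an assignment of colors from $\{1,\dots,k\}$ to the vertices such that adjacent vertices get different colors (not all colors need be used). For a $k$-vertex-coloring $f$ and a color $j$, $M(f,j)$ is the set of vertices of color $j$. Two $k$-vertex-colorings $f,g$ of $G$ differ by an $m$-colored subgraph if there is a set $S$ of $m$ colors with $M(f,j)\ne M(g,j)$ for $j\in S$ and $M(f,j)=M(g,j)$ for $j\notin S$. Write $f\sim_r g$ if there is a sequence $f=f_0,f_1,\dots,f_s=g$ of $k$-vertex-colorings of $G$ such that $f_i$ differs from $f_{i-1}$ by a $k_i$-colored subgraph with $k_i\le r$ for each $i$. Let $S(G)$ be the set of stable (independent) sets of $G$, including $\emptyset$, and let $R=\mathbb{K}[x_S : S\in S(G)]$ be the polynomial ring over a field $\mathbb{K}$ with one variable per stable set. For a $k$-vertex-coloring $f$ of an induced subgraph of $G$, put $\mathbf{x}_f=\prod_{\ell=1}^k x_{f^{-1}(\ell)}\in R$ (unused colors contribute the variable $x_\emptyset$). The $r$-coloring ideal of $G$ is $$J_{G,r}=\langle \mathbf{x}_f-\mathbf{x}_g : f \text{ and } g \text{ are } k\text{-vertex-colorings of a common induced subgraph of } G \text{ with } k\le r\rangle\subset R.$$ *)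

(* Defs.v *)
From mathcomp Require Import all_boot all_order all_algebra.
From mathcomp Require Import mpoly.

Set Implicit Arguments.
Unset Strict Implicit.
Unset Printing Implicit Defensive.

Import GRing.Theory.

Local Open Scope ring_scope.

Record sgraph := SGraph {
  vertex :> finType;
  adj : rel vertex;
  adj_sym : ssrbool.symmetric adj;
  adj_irr : irreflexive adj }.

Section Graphs.

Variable G : sgraph.

Section Induced.

Variable A : {set G}.

Definition induced_vertex : finType := {x : G | x \in A}.

Definition induced_adj : rel induced_vertex := relpre val (@adj G).

Fact induced_adj_sym : ssrbool.symmetric induced_adj.
Proof. by move=> x y; rewrite /induced_adj /= adj_sym. Qed.

Fact induced_adj_irr : irreflexive induced_adj.
Proof. by move=> x; rewrite /induced_adj /= adj_irr. Qed.

Definition induced : sgraph := SGraph induced_adj_sym induced_adj_irr.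

End Induced.

Definition is_stable (S : {set G}) : bool :=
  [forall x in S, forall y in S, ~~ adj x y].

Definition stable_set : finType := {S : {set G} | is_stable S}.

Definition proper_coloring k (f : {ffun G -> 'I_k}) : bool :=
  [forall x, forall y, adj x y ==> (f x != f y)].

Definition coloring k : finType := {f : {ffun G -> 'I_k} | proper_coloring f}.

Lemma color_class_stable k (f : coloring k) (j : 'I_k) :
  is_stable [set x | val f x == j].
Proof.
apply/forall_inP=> x; rewrite inE => /eqP fx.
apply/forall_inP=> y; rewrite inE => /eqP fy; apply/negP=> xy.
by have /forallP/(_ x)/forallP/(_ y) := valP f; rewrite xy /= fx fy eqxx.
Qed.

Definition color_class k (f : coloring k) (j : 'I_k) : stable_set :=
  Sub [set x | val f x == j] (color_class_stable f j).

(* The set of colors by which two colorings differ is determined by them, so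
   "differing by an m-colored subgraph" says that it has m elements. *)
Definition diff_colors k (f g : coloring k) : {set 'I_k} :=
  [set j | color_class f j != color_class g j].

Definition differ_by (m k : nat) (f g : coloring k) : bool :=
  #|diff_colors f g| == m.

Definition recolor_step (r k : nat) : rel (coloring k) :=
  fun f g => [exists m : 'I_r.+1, differ_by m f g].

Definition recolor_equiv (r k : nat) (f g : coloring k) : Prop :=
  exists2 s : seq (coloring k),
    path (@recolor_step r k) f s & last f s = g.

End Graphs.

Lemma induced_stable (G : sgraph) (A : {set G}) (S : stable_set (induced A)) :
  is_stable [set val x | x in val S].
Proof.
apply/forall_inP=> _ /imsetP[x xS ->]; apply/forall_inP=> _ /imsetP[y yS ->].
by have /forall_inP/(_ x xS)/forall_inP/(_ y yS) := valP S.
Qed.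

Definition stable_of_induced (G : sgraph) (A : {set G})
    (S : stable_set (induced A)) : stable_set G :=
  Sub [set val x | x in val S] (induced_stable S).

Definition ideal_gen (R : comNzRingType) (P : R -> Prop) (p : R) : Prop :=
  exists2 s : seq (R * R),
    (forall c, c \in s -> P c.2) & p = \sum_(c <- s) c.1 * c.2.

Section ColoringIdeal.

Variables (K : fieldType) (G : sgraph).

(* One variable per stable set: the variables of [{mpoly K[n]}] are numbered by
   ['I_n], so they are indexed through [enum_rank]. *)
Definition stable_ring := {mpoly K[#|stable_set G|]}.

Definition stable_var (S : stable_set G) : stable_ring := 'X_(enum_rank S).

Definition coloring_monomial k (f : coloring G k) : stable_ring :=
  \prod_(l < k) stable_var (color_class f l).

Definition induced_coloring_monomial (A : {set G}) k (f : coloring (induced A) k)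
    : stable_ring :=
  \prod_(l < k) stable_var (stable_of_induced (color_class f l)).

Definition coloring_ideal_gens (r : nat) (p : stable_ring) : Prop :=
  exists (A : {set G}) (k : nat) (f g : coloring (induced A) k),
    (k <= r)%N /\ p = induced_coloring_monomial f - induced_coloring_monomial g.

Definition coloring_ideal (r : nat) : stable_ring -> Prop :=
  ideal_gen (coloring_ideal_gens r).

End ColoringIdeal.

Arguments stable_var K {G} S.
Arguments coloring_monomial K {G k} f.
Arguments induced_coloring_monomial K {G A k} f.
Arguments coloring_ideal_gens K G r p : clear implicits.
Arguments coloring_ideal K G r p : clear implicits.

(* Main.v *)
(** One implication restricts two colorings that differ on a set of at most [r]
    colors to the union of the corresponding color classes.  For the converse,
    fix [f] and let [L] be the linear form that adds up the coefficients at the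
    monomials [x_h] with [f ~_r h].  If [u x_f' = x_h], then the color classes of
    [f'] are classes of [h], and replacing [f'] by [g'] there recolors [h] into a
    coloring with monomial [u x_g'] that differs from [h] in at most [r] colors.
    Hence [L] vanishes on the coloring ideal, so [x_f - x_g] in the ideal forces
    [x_g = x_h] for some [h] with [f ~_r h].  Then [g] and [h] agree up to a
    permutation of the colors, and a transposition changes only two classes. *)
Require Import Defs.
From mathcomp Require Import all_boot all_order all_algebra all_fingroup.
From mathcomp Require Import mpoly.

Set Implicit Arguments.
Unset Strict Implicit.
Unset Printing Implicit Defensive.

Import GRing.Theory.

Local Open Scope ring_scope.

Section ColorClasses.

Variable G : sgraph.

Lemma mem_color_class k (f : coloring G k) j x :
  (x \in val (color_class f j)) = (val f x == j).
Proof. by rewrite inE. Qed.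

Lemma coloring_neq k (f : coloring G k) x y : adj x y -> val f x != val f y.
Proof. by have /forallP/(_ x)/forallP/(_ y)/implyP := valP f. Qed.

Lemma proper_coloringP k (f : {ffun G -> 'I_k}) :
  (forall x y, adj x y -> f x != f y) -> proper_coloring f.
Proof. by move=> f_neq; do 2![apply/forallP=> ?]; apply/implyP/f_neq. Qed.

End ColorClasses.

(** * Restricting colorings to unions of color classes, and recoloring there *)

Section InducedColorings.

Variable G : sgraph.

Lemma mem_stable_of_induced (A : {set G}) (S : stable_set (induced A))
    (y : induced A) :
  (val y \in val (stable_of_induced S)) = (y \in val S).
Proof. exact/mem_imset/val_inj. Qed.

Lemma stable_of_induced_sub (A : {set G}) (S : stable_set (induced A)) x :
  x \in val (stable_of_induced S) -> x \in A.
Proof. by case/imsetP=> y _ ->; apply: (valP y). Qed.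

Lemma recolor_stepE r k (f g : coloring G k) :
  recolor_step r f g = (#|diff_colors f g| <= r)%N.
Proof.
apply/existsP/idP=> [[m /eqP->]|le_r]; first exact: (ltn_ord m).
by exists (Ordinal (le_r : (_ < r.+1)%N)); apply: eqxx.
Qed.

Lemma recolor_equivP r k (f g : coloring G k) :
  recolor_equiv r f g <-> connect (@recolor_step G r k) f g.
Proof.
by split=> [[s f_s s_g]|/connectP[s f_s ->]]; [apply/connectP|]; exists s.
Qed.

(** All differing colors lie in [codom s], which has at most [n] elements. *)
Lemma recolor_step_off r k n (s : 'I_n -> 'I_k) (f g : coloring G k) :
  (n <= r)%N ->
  (forall j, j \notin codom s -> color_class f j = color_class g j) ->
  recolor_step r f g.
Proof.
move=> le_nr fg; rewrite recolor_stepE; apply: leq_trans le_nr.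
rewrite -[n]card_ord -(size_codom s); apply: leq_trans (card_size _).
apply/subset_leq_card/subsetP=> j; rewrite inE.
by apply: contraR => /fg->.
Qed.

Lemma color_restrict k (D : {set 'I_k}) (A : {set G}) (h : coloring G k) :
  (forall x, (x \in A) = (val h x \in D)) ->
  exists h' : coloring (induced A) #|D|,
    forall l, stable_of_induced (color_class h' l) = color_class h (enum_val l).
Proof.
(* [enum_rank_in] requires some element of [D]; the color of [y] itself serves. *)
move=> AD; have DA (y : induced A) : val h (val y) \in D.
  by rewrite -AD; apply: (valP y).
pose h' := [ffun y : induced A => enum_rank_in (DA y) (val h (val y))].
have h'K y : enum_val (h' y) = val h (val y) by rewrite ffunE enum_rankK_in.
have h'_col : proper_coloring h'.
  apply: (@proper_coloringP (induced A) _ h') => x y xy.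
  apply: contraNneq (coloring_neq h xy).
  by move=> eq_h; rewrite -!h'K eq_h.
exists (Sub h' h'_col) => l; apply/val_inj/setP=> x.
apply/idP/idP=> [/imsetP[y yl ->]|].
  by rewrite inE in yl; rewrite mem_color_class -h'K (eqP yl).
rewrite mem_color_class => /eqP hx.
have xA : x \in A by rewrite AD hx; apply: enum_valP.
pose y : induced A := Sub x xA.
rewrite -[x]/(val y) mem_stable_of_induced mem_color_class /=.
by apply/eqP/enum_val_inj; rewrite h'K.
Qed.

(** The classes of [f] cover [A], so [A] is exactly the set of vertices that [h] colors from
    [codom s]. Take [s \o g] on [A] and [h] elsewhere: an edge leaving [A] joins a color in
    [codom s] to one outside it. *)
Lemma color_replace k n (s : 'I_n -> 'I_k) (A : {set G}) (h : coloring G k)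
    (f g : coloring (induced A) n) :
  injective s ->
  (forall l, color_class h (s l) = stable_of_induced (color_class f l)) ->
  exists h' : coloring G k,
    (forall l, color_class h' (s l) = stable_of_induced (color_class g l)) /\
    (forall j, j \notin codom s -> color_class h j = color_class h' j).
Proof.
move=> s_inj hf.
have AE x : (x \in A) = (val h x \in codom s).
  apply/idP/codomP=> [xA|[l hx]]; last first.
    apply: (@stable_of_induced_sub _ (color_class f l)).
    by rewrite -hf mem_color_class hx.
  pose y : induced A := Sub x xA; exists (val f y).
  by apply/eqP; rewrite -mem_color_class hf (mem_stable_of_induced _ y)
    mem_color_class.
pose h' := [ffun x => if insub x is Some y then s (val g (y : induced A))
                      else val h x].
have h'in (y : induced A) : h' (val y) = s (val g y) by rewrite ffunE valK.
have h'out x : x \notin A -> h' x = val h x by move=> xA; rewrite ffunE insubN.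
have h'A x : (x \in A) = (h' x \in codom s).
  have [xA|xA] := boolP (x \in A); last by rewrite h'out // -AE (negPf xA).
  by rewrite (h'in (Sub x xA)) codom_f.
have h'_col : proper_coloring h'.
  apply: proper_coloringP => x y xy.
  have [xA|xA] := boolP (x \in A); have [yA|yA] := boolP (y \in A).
  - pose x' : induced A := Sub x xA; pose y' : induced A := Sub y yA.
    rewrite (h'in x') (h'in y') (inj_eq s_inj).
    exact: (@coloring_neq _ _ g x' y' xy).
  - by apply: contraNneq yA => eq_h; rewrite h'A -eq_h -h'A.
  - by apply: contraNneq xA => eq_h; rewrite h'A eq_h -h'A.
  - by rewrite !h'out // coloring_neq.
exists (Sub h' h'_col); split=> [l|j sj]; apply/val_inj/setP=> x.
  rewrite mem_color_class SubK; have [xA|xA] := boolP (x \in A).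
    pose y : induced A := Sub x xA.
    rewrite (h'in y) (inj_eq s_inj) -(mem_color_class g l y).
    exact/esym/(mem_stable_of_induced (color_class g l) y).
  rewrite [RHS](contraNF (@stable_of_induced_sub _ _ x) xA).
  by apply: contraNF xA => /eqP h'x; rewrite h'A h'x codom_f.
rewrite !mem_color_class SubK; have [xA|xA] := boolP (x \in A); last first.
  by rewrite h'out.
(* On [A] both colorings take values in [codom s], hence never the value [j]. *)
have sjF i : i \in codom s -> (i == j) = false.
  by apply: contraTF => /eqP->.
by rewrite !sjF // -?AE -?h'A.
Qed.

End InducedColorings.

(** * Permutations of the colors *)

Section Relabelling.

Variables (G : sgraph) (k : nat).

Lemma relabel_proper (s : {perm 'I_k}) (h : coloring G k) :
  proper_coloring [ffun x => s (val h x)].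
Proof.
apply: proper_coloringP => x y xy; rewrite !ffunE (inj_eq perm_inj).
exact: coloring_neq.
Qed.

Definition relabel s h : coloring G k := Sub _ (relabel_proper s h).

Lemma relabel1 h : relabel 1%g h = h.
Proof. by apply/val_inj/ffunP=> x; rewrite ffunE perm1. Qed.

Lemma relabelM s t h : relabel (s * t)%g h = relabel t (relabel s h).
Proof. by apply/val_inj/ffunP=> x; rewrite !ffunE permM. Qed.

Lemma relabel_tperm_step r a b h :
  (2 <= r)%N -> recolor_step r h (relabel (tperm a b) h).
Proof.
move=> r2; rewrite recolor_stepE; apply: leq_trans r2.
apply: (@leq_trans #|[set a; b]|); last by rewrite cards2; case: eqP.
apply/subset_leq_card/subsetP=> j; rewrite !inE; apply: contraR.
rewrite negb_or ![j == _]eq_sym => /andP[ja jb].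
apply/eqP/val_inj/setP=> x; rewrite !mem_color_class ffunE.
by rewrite -[j in RHS](tpermD ja jb) (inj_eq perm_inj).
Qed.

Lemma relabel_connect r s h :
  (2 <= r)%N -> connect (@recolor_step G r k) h (relabel s h).
Proof.
move=> r2; have [ts -> _] := prod_tpermP s.
elim: ts h => [|t ts IH] h; first by rewrite big_nil relabel1.
rewrite big_cons relabelM.
exact: connect_trans (connect1 (relabel_tperm_step _ _ _ r2)) (IH _).
Qed.

End Relabelling.

(** * Exponent vectors of products of stable-set variables *)

Section ClassMonomials.

Variable G : sgraph.

Definition class_mnm k (c : 'I_k -> stable_set G) : 'X_{1..#|stable_set G|} :=
  (\sum_(l < k) U_(enum_rank (c l)))%MM.

Lemma prod_stable_var (K : fieldType) k (c : 'I_k -> stable_set G) :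
  \prod_(l < k) stable_var K (c l) = 'X_[class_mnm c].
Proof. exact: mprodXE. Qed.

Lemma class_mnm_count k (c : 'I_k -> stable_set G) S :
  class_mnm c (enum_rank S) = count_mem S (codom c).
Proof.
rewrite mnm_sumE -sum1_count codomE big_map big_enum_cond [RHS]big_mkcond /=.
by apply: eq_bigr => l _; rewrite mnm1E (inj_eq enum_rank_inj); case: eqP.
Qed.

Lemma class_mnm_split k n (s : 'I_n -> 'I_k) (c : 'I_k -> stable_set G) :
  injective s ->
  class_mnm c = (class_mnm (c \o s) +
                 \sum_(j | j \notin codom s) U_(enum_rank (c j)))%MM.
Proof.
move=> s_inj; have s_uniq : uniq (codom s) by rewrite map_inj_uniq ?enum_uniq.
rewrite /class_mnm (bigID (mem (codom s))) /=; congr (_ + _)%MM.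
by rewrite -(big_uniq _ s_uniq) codomE big_map big_enum.
Qed.

Lemma class_mnm_embed k n u (c : 'I_k -> stable_set G)
    (d : 'I_n -> stable_set G) :
  class_mnm c = (u + class_mnm d)%MM ->
  exists2 s : 'I_n -> 'I_k, injective s & forall l, c (s l) = d l.
Proof.
move=> cd; have /count_subseqP[w /perm_to_subseq[v wv] dw] :
    forall S, (count_mem S (codom d) <= count_mem S (codom c))%N.
  by move=> S; rewrite -!class_mnm_count cd mnmDE leq_addl.
have {wv dw}cv : perm_eq (codom c) (codom d ++ v).
  by apply: perm_trans wv _; rewrite perm_cat2r perm_sym.
(* With [k] replaced by [n + size v], both listings are tuples of one length, which yields a
   permutation [p] of positions; [s] is [p] on the first [n] of them. *)
have kE : k = (n + size v)%N.
  by have := perm_size cv; rewrite size_cat !size_codom !card_ord.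
clear cd w; subst k.
have {}cv : perm_eq (cat_tuple [tuple d l | l < n] (in_tuple v))
    [tuple c l | l < n + size v].
  by rewrite perm_sym /= -!codomE.
have /tuple_permP[p pE] := cv.
exists (p \o lshift (size v)) => [|l /=]; first exact/inj_comp/lshift_inj/perm_inj.
have := congr1 (@tnth _ _ ^~ (lshift (size v) l)) (val_inj pE).
by rewrite tnth_mktuple tnth_lshift !tnth_mktuple.
Qed.

End ClassMonomials.

(** * A linear form that vanishes on a binomial ideal *)

Section BinomialIdeals.

Variables (K : fieldType) (n : nat).

Implicit Types (S : seq 'X_{1..n}) (p q : {mpoly K[n]}) (a b u : 'X_{1..n}).

(** [undup] makes every monomial of [S] count once, so that the form takes only the values 0 and 1
    on monomials, in any characteristic. *)
Definition coeff_sum S p : K := \sum_(m <- undup S) p@_m.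

Lemma coeff_sum_sum S (I : Type) (s : seq I) (F : I -> {mpoly K[n]}) :
  coeff_sum S (\sum_(i <- s) F i) = \sum_(i <- s) coeff_sum S (F i).
Proof.
rewrite /coeff_sum exchange_big; apply: eq_bigr => m _; exact: raddf_sum.
Qed.

Lemma coeff_sumZ S (x : K) p : coeff_sum S (x *: p) = x * coeff_sum S p.
Proof. by rewrite mulr_sumr; apply: eq_bigr => m _; rewrite mcoeffZ. Qed.

Lemma coeff_sumB S p q : coeff_sum S (p - q) = coeff_sum S p - coeff_sum S q.
Proof. by rewrite -sumrB; apply: eq_bigr => m _; rewrite mcoeffB. Qed.

Lemma coeff_sumX S a : coeff_sum S 'X_[a] = (a \in S)%:R.
Proof.
rewrite /coeff_sum; under eq_bigr do rewrite mcoeffX.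
rewrite -mem_undup; have [aS|aS] := boolP (a \in undup S).
  rewrite (bigD1_seq a) ?undup_uniq //= eqxx big1 ?addr0 // => m.
  by rewrite eq_sym => /negPf->.
by rewrite big_seq big1 // => m; case: eqP => // <-; rewrite (negPf aS).
Qed.

Lemma binomial_ideal_closed S (P : {mpoly K[n]} -> Prop) a b :
  (forall q, P q -> exists a' b',
     q = 'X_[a'] - 'X_[b'] /\ forall u, ((u + a')%MM \in S) = ((u + b')%MM \in S)) ->
  ideal_gen P ('X_[a] - 'X_[b]) -> (a \in S) = (b \in S).
Proof.
move=> P_closed [s sP abE]; have: coeff_sum S ('X_[a] - 'X_[b]) = 0.
  rewrite abE coeff_sum_sum big_seq big1 // => c /sP/P_closed[a' [b' [-> S_ab]]].
  (* Expanding the cofactor into monomials leaves multiples of ['X_[u + a'] - 'X_[u + b']], whose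
     two exponents are both in [S] or both outside. *)
  rewrite [c.1]mpolyE mulr_suml coeff_sum_sum big1 // => u _.
  rewrite -scalerAl mulrBr -!mpolyXD coeff_sumZ coeff_sumB !coeff_sumX S_ab.
  by rewrite subrr mulr0.
rewrite coeff_sumB !coeff_sumX => /eqP; rewrite subr_eq0.
by do 2!case: (_ \in S) => //; rewrite ?[_ == 1]eq_sym oner_eq0.
Qed.

End BinomialIdeals.

(** * Recoloring steps and generators of the coloring ideal *)

Section ColoringIdeal.

Variables (K : fieldType) (G : sgraph).

Lemma recolor_step_gens r k (f g : coloring G k) :
  recolor_step r f g ->
  exists2 c : stable_ring K G * stable_ring K G,
    coloring_ideal_gens K G r c.2 &
    coloring_monomial K f - coloring_monomial K g = c.1 * c.2.
Proof.
rewrite recolor_stepE => le_r; set D := diff_colors f g in le_r.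
have fgD j : j \notin D -> color_class f j = color_class g j.
  by rewrite inE negbK => /eqP.
pose A := [set x | val f x \in D].
have [x|f' f'E] := @color_restrict G k D A f; first by rewrite inE.
(* The same [A] serves for [g]: classes of colors outside [D] coincide, so a vertex has its
   [f]-color in [D] exactly when it has its [g]-color there. *)
have [x|g' g'E] := @color_restrict G k D A g.
  rewrite inE; have [fx|fx] := boolP (val f x \in D).
    apply/esym; apply: contraLR fx => gx.
    have: x \in val (color_class g (val g x)) by rewrite mem_color_class.
    by rewrite -fgD // mem_color_class => /eqP->.
  have: x \in val (color_class f (val f x)) by rewrite mem_color_class.
  by rewrite fgD // mem_color_class => /eqP->; rewrite (negPf fx).
have sD j : j \notin codom (@enum_val _ (mem D)) -> j \notin D.
  by apply: contra => jD; rewrite -(enum_rankK_in jD jD) codom_f.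
(* The cofactor is the product of the variables of the classes common to [f] and [g]. *)
pose w := (\sum_(j | j \notin codom (@enum_val _ (mem D)))
  U_(enum_rank (color_class f j)))%MM.
exists ('X_[w], induced_coloring_monomial K f' - induced_coloring_monomial K g').
  by exists A, #|D|, f', g'.
rewrite /coloring_monomial /induced_coloring_monomial !prod_stable_var /=.
have fE : class_mnm (color_class f) =
    (w + class_mnm (fun l => stable_of_induced (color_class f' l)))%MM.
  rewrite (class_mnm_split _ (@enum_val_inj _ (mem D))) addmC; congr (_ + _)%MM.
  by apply: eq_bigr => l _; rewrite f'E.
have gE : class_mnm (color_class g) =
    (w + class_mnm (fun l => stable_of_induced (color_class g' l)))%MM.
  rewrite (class_mnm_split _ (@enum_val_inj _ (mem D))) addmC; congr (_ + _)%MM.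
    by apply: eq_bigr => j /sD/fgD->.
  by apply: eq_bigr => l _; rewrite g'E.
by rewrite fE gE !mpolyXD mulrBr.
Qed.

(** The binomials of consecutive colorings on the path telescope. *)
Lemma recolor_equiv_ideal r k (f g : coloring G k) :
  recolor_equiv r f g ->
  coloring_ideal K G r (coloring_monomial K f - coloring_monomial K g).
Proof.
case=> s f_s <-{g}; elim: s f f_s => [|h s IH] f /=.
  by rewrite subrr => _; exists [::]; rewrite ?big_nil.
case/andP=> /recolor_step_gens[c c_gen fh] /IH[u u_gen hE].
exists (c :: u); last by rewrite big_cons -fh -hE addrA subrK.
by move=> d; rewrite inE => /predU1P[->|/u_gen].
Qed.

Lemma gens_exchange r k n (A : {set G}) (f' g' : coloring (induced A) n)
    (h : coloring G k) u :
  (n <= r)%N ->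
  class_mnm (color_class h) =
    (u + class_mnm (fun l => stable_of_induced (color_class f' l)))%MM ->
  exists2 h' : coloring G k, recolor_step r h h' &
    class_mnm (color_class h') =
      (u + class_mnm (fun l => stable_of_induced (color_class g' l)))%MM.
Proof.
move=> le_nr hE; have [s s_inj hs] := class_mnm_embed hE.
have [h' [h's h'E]] := color_replace g' s_inj hs.
exists h'; first exact: (recolor_step_off le_nr h'E).
move: hE; rewrite !(class_mnm_split _ s_inj) addmC.
have -> : class_mnm (color_class h \o s) =
    class_mnm (fun l => stable_of_induced (color_class f' l)).
  by apply: eq_bigr => l _; rewrite /= hs.
have -> : class_mnm (color_class h' \o s) =
    class_mnm (fun l => stable_of_induced (color_class g' l)).
  by apply: eq_bigr => l _; rewrite /= h's.
(* Cancelling the part of [f'] identifies [u] with the classes of [h] off [codom s], which [h']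
   keeps. *)
move/addIm <-; rewrite addmC; congr (_ + _)%MM.
by apply: eq_bigr => j /h'E->.
Qed.

(** With [u = 0] the embedding of classes is an injection of ['I_k] into itself, that is, a
    permutation of the colors. *)
Lemma same_class_mnm_connect r k (g h : coloring G k) :
  (2 <= r)%N -> class_mnm (color_class h) = class_mnm (color_class g) ->
  connect (@recolor_step G r k) h g.
Proof.
move=> r2; rewrite -[class_mnm (color_class h)]add0m => /esym/class_mnm_embed.
case=> s s_inj hs.
suff -> : g = relabel (perm s_inj) h by apply: relabel_connect.
apply/val_inj/ffunP=> x; rewrite ffunE permE; apply/eqP.
by rewrite -mem_color_class hs mem_color_class.
Qed.

End ColoringIdeal.

Theorem theorem4p2 (K : fieldType) (G : sgraph) (r k : nat)
    (f g : coloring G k) (hr : (2 <= r)%N) :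
  recolor_equiv r f g <-> coloring_ideal K G r (coloring_monomial K f - coloring_monomial K g).
Proof.
split; first exact: recolor_equiv_ideal.
rewrite /coloring_monomial !prod_stable_var => fg_ideal.
apply/recolor_equivP.
(* The support of the linear form: exponents of all colorings reachable from [f]. *)
pose S := [seq class_mnm (color_class h) | h <- enum (connect (@recolor_step G r k) f)].
suff /mapP[h] : class_mnm (color_class g) \in S.
  by rewrite mem_enum => fh /esym/(same_class_mnm_connect hr); apply: connect_trans.
have S_exchange n (A : {set G}) (f' g' : coloring (induced A) n) u :
    (n <= r)%N ->
    (u + class_mnm (fun l => stable_of_induced (color_class f' l)))%MM \in S ->
    (u + class_mnm (fun l => stable_of_induced (color_class g' l)))%MM \in S.
  move=> le_nr /mapP[h]; rewrite mem_enum => fh /esym/(gens_exchange g' le_nr).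
  case=> h' hh' <-; apply: map_f; rewrite mem_enum.
  exact: connect_trans fh (connect1 hh').
rewrite -(binomial_ideal_closed _ fg_ideal).
  by apply: map_f; rewrite mem_enum; apply: connect0.
move=> _ [A [n [f' [g' [le_nr ->]]]]].
rewrite /induced_coloring_monomial !prod_stable_var; do 2!eexists; split=> // u.
(* The reverse implication is [S_exchange] with [f'] and [g'] swapped. *)
by apply/idP/idP; apply: S_exchange.
Qed.
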